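(* If $G$ is a platypus of order $n$, then $\Delta(G) \le n - 4$. For $n \le 9$ there are, up to isomorphism, precisely four platypuses, each of order $9$, one of maximum degree $3$ and the other three of maximum degree $4$; hence the bound is not sharp for $n = 9$. However, for all $n \ge 10$ there exists a platypus $G$ of order $n$ with $\Delta(G) = n - 4$.
   Context: Graphs are finite and simple, with at least three vertices (so the trivial platypus $K_2$ is ignored). A graph is hamiltonian (traceable) if it contains a spanning cycle (spanning path). A platypus is a non-hamiltonian graph $G$ such that for every vertex $v$ of $G$ the vertex-deleted subgraph $G-v$ is traceable. The order of a graph is its number of vertices, and $\Delta(G)$ denotes the maximum degree of $G$. *)

(* Defs.v *)
From mathcomp Require Import all_boot.

Set Implicit Arguments.
Unset Strict Implicit.
Unset Printing Implicit Defensive.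

Record sgraph := SGraph {
  vertex :> finType;
  edge : rel vertex;
  edge_sym : symmetric edge;
  edge_irrefl : irreflexive edge }.

Definition order_of (G : sgraph) : nat := #|G|.

Definition nbhd (G : sgraph) (x : G) : {set G} := [set y | edge x y].
Definition degree (G : sgraph) (x : G) : nat := #|nbhd x|.
Definition max_degree (G : sgraph) : nat := \max_(x : G) degree x.

Definition isomorphic (G H : sgraph) : Prop :=
  exists2 f : G -> H, bijective f & forall x y, edge (f x) (f y) = edge x y.

Section Induced.
Variables (G : sgraph) (S : {set G}).

Definition induced_edge : rel {x : G | x \in S} :=
  [rel u v | edge (val u) (val v)].

Lemma induced_sym : symmetric induced_edge.
Proof. by move=> u v; exact: edge_sym. Qed.

Lemma induced_irrefl : irreflexive induced_edge.
Proof. by move=> u; exact: edge_irrefl. Qed.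

Definition induced : sgraph := SGraph induced_sym induced_irrefl.
End Induced.

Definition delete_vertex (G : sgraph) (v : G) : sgraph := induced [set~ v].

(* The bound on the size is needed because the library's [cycle] also accepts
   the empty sequence and a closed walk back and forth along one edge. *)
Definition hamiltonian (G : sgraph) : Prop :=
  exists c : seq G,
    [/\ 3 <= size c, cycle (@edge G) c, uniq c & forall x : G, x \in c].

Definition traceable (G : sgraph) : Prop :=
  exists (x : G) (p : seq G),
    [/\ path (@edge G) x p, uniq (x :: p) & forall y : G, y \in x :: p].

(* The bound on the order excludes the degenerate case K_2. *)
Definition platypus (G : sgraph) : Prop :=
  [/\ 3 <= order_of G,
      ~ hamiltonian G
    & forall v : G, traceable (delete_vertex v)].

(* Main.v *)
(* The bound.  Suppose at most two vertices other than [x] are not adjacent to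
   [x].  A hamiltonian path of [G - x] cannot have both ends adjacent to [x], and
   rotating it yields one with exactly one end [a] not adjacent to [x].  Every
   rotation at [a] produces a second nonneighbour of [x], always the same vertex
   [b]; hence [a] and, symmetrically, [b] have degree 2 and a common neighbour
   [c].  A hamiltonian path of [G - c] must run from [a] to [b], and [c] closes
   it to a hamiltonian cycle.

   Orders at most 9.  Let [x] have maximum degree and number the vertices 0 for
   [x] and 1, ..., n - 1 along a hamiltonian path of [G - x].  A backtracking
   search over the remaining edges, pruned by hamiltonicity of the edges already
   chosen and by traceability of the vertex-deleted subgraphs of the edges still
   possible, leaves only the four graphs consisting of two triangles joined by
   three paths of length 2, k of which have their ends joined (k = 0, ..., 3).

   Orders n >= 10.  A platypus of order 10 contains a vertex of degree 2 in a
   triangle with the vertex of degree 6; it is replaced by a clique of n - 9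
   twins, and a twin can always be removed from a hamiltonian cycle because its
   neighbours form a clique. *)

Require Import Defs.
From mathcomp Require Import all_boot.

Set Implicit Arguments.
Unset Strict Implicit.
Unset Printing Implicit Defensive.

(** * The bound on the maximum degree *)

Section Sorted.
Variables (T : eqType) (e : rel T).
Hypothesis e_sym : symmetric e.

Lemma sorted_has_neighbour (q : seq T) a b :
  sorted e q -> a \in q -> b \in q -> b != a -> exists2 c, c \in q & e a c.
Proof.
move=> eq aq; case/splitPr: aq eq => q1 [|c q2] eq bq ba; last first.
  exists c; first by rewrite mem_cat !inE eqxx !orbT.
  by move: eq => /cat_sorted2[_] /= /andP[].
case/lastP: q1 => [|q1 c] in eq bq *; first by rewrite /= inE (negPf ba) in bq.
exists c; first by rewrite mem_cat mem_rcons inE eqxx.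
by move: eq; rewrite cats1 -cats1 cat_rcons => /cat_sorted2[_] /=; rewrite andbT e_sym.
Qed.

(** An interior vertex of a path has two distinct neighbours on it, its predecessor and its
    successor. *)
Lemma sorted_leaf_end (q : seq T) a :
  sorted e q -> uniq q -> a \in q -> {in q &, forall b c, e a b -> e a c -> b = c} ->
  exists q', q = a :: q' \/ q = rcons q' a.
Proof.
move=> eq Uq aq; case/splitPr: aq eq Uq => q1 [|c q2] eq Uq Hh.
  by exists q1; right; rewrite cats1.
case/lastP: q1 => [|q1 b] in eq Uq Hh *; first by exists (c :: q2); left.
have bq : b \in rcons q1 b ++ a :: c :: q2 by rewrite mem_cat mem_rcons inE eqxx.
have cq : c \in rcons q1 b ++ a :: c :: q2 by rewrite mem_cat !inE eqxx !orbT.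
move: eq (Uq); rewrite {1}cat_rcons => /cat_sorted2[_] /= /and3P[ba ac _].
rewrite cat_uniq => /and3P[_ /hasPn/(_ c)]; rewrite !inE eqxx orbT => /(_ isT).
by rewrite mem_rcons inE (Hh c b cq bq ac) ?eqxx // e_sym.
Qed.

Lemma sorted_rev (q : seq T) : sorted e (rev q) = sorted e q.
Proof. by rewrite rev_sorted; apply: eq_sorted => x y; exact: e_sym. Qed.

End Sorted.

Lemma traceable_deleteP (G : sgraph) (v : G) :
  traceable (delete_vertex v) <->
  exists s : seq G, [/\ s != [::], sorted (@edge G) s, uniq s
                      & forall y, (y \in s) = (y != v)].
Proof.
split=> [[x [p [exp Uxp allp]]]|[s [s0 es Us ms]]].
  exists (map val (x :: p)); split=> //; first by rewrite sorted_map.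
    by rewrite (map_inj_uniq val_inj).
  move=> y; apply/mapP/idP => [[z _ ->]|yv].
    by have := valP z; rewrite !inE.
  have yS : y \in [set~ v] by rewrite !inE.
  by exists (Sub y yS); rewrite ?allp.
pose s' : seq (delete_vertex v) := pmap insub s.
have vs' : map val s' = s.
  rewrite pmap_filter; last exact: insubK.
  apply/all_filterP/allP => y; rewrite ms => yv.
  by rewrite /= insubT // !inE.
have es' : sorted (@edge (delete_vertex v)) s' by rewrite -vs' sorted_map in es.
have Us' : uniq s' by rewrite -(map_inj_uniq val_inj) vs'.
have ms' y : y \in s'.
  by rewrite -(mem_map val_inj) vs' ms; have := valP y; rewrite !inE.
case: {vs'}s' (esym vs') es' Us' ms' => [|x p] //= E exp Uxp allp.
  by rewrite E in s0.
by exists x, p.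
Qed.

Lemma hamiltonian_cycle (G : sgraph) (c : seq G) :
  2 < order_of G -> cycle (@edge G) c -> uniq c -> (forall y, y \in c) ->
  hamiltonian G.
Proof.
move=> n3 cc Uc mc; exists c; split=> //.
by rewrite -(card_uniqP Uc) (eq_card (B := G)) // => y; rewrite mc.
Qed.

(** Serves to identify two neighbours of an end that follow the same nonneighbour of [x] on a
    path. *)
Lemma uniq_succ (T : eqType) (t r1 r2 s1 s2 : seq T) b c d :
  uniq t -> t = r1 ++ b :: c :: r2 -> t = s1 ++ b :: d :: s2 -> c = d.
Proof.
have succ u p1 p2 : uniq t -> t = p1 ++ b :: u :: p2 -> u = nth b t (index b t).+1.
  move=> Ut Et; rewrite Et cat_uniq in Ut *.
  case/and3P: Ut => _ /hasPn/(_ b); rewrite inE eqxx => /(_ isT) /negPf bp1 _.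
  by rewrite index_cat bp1 /= eqxx addn0 nth_cat ltnNge leqnSn /= subSn ?subnn.
by move=> Ut Er Es; rewrite (succ c _ _ Ut Er) (succ d _ _ Ut Es).
Qed.

(** * Hamiltonian paths of vertex-deleted subgraphs *)

Section PlatypusPaths.
Variable G : sgraph.
Hypothesis platG : platypus G.

Notation E := (@edge G).

Definition hpath_del (v : G) s :=
  [/\ sorted E s, uniq s & forall y, (y \in s) = (y != v)].

Lemma platypus_path v : exists s, hpath_del v s.
Proof.
by have [_ _ /(_ v) /traceable_deleteP[s [_ es Us ms]]] := platG; exists s.
Qed.

Lemma platypus_no_cycle c : cycle E c -> uniq c -> (forall y, y \in c) -> False.
Proof.
by have [n3 nham _] := platG => cc Uc mc; apply: nham; apply: hamiltonian_cycle mc.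
Qed.

(** Otherwise [v] would close the path to a hamiltonian cycle. *)
Lemma hpath_del_ends v a t : hpath_del v (a :: t) -> E v a -> ~~ E v (last a t).
Proof.
move=> [es Us ms] va; apply/negP => vz.
apply: (@platypus_no_cycle (v :: a :: t)).
- by rewrite /= va /= rcons_path; apply/andP; split; rewrite // edge_sym.
- by rewrite cons_uniq Us ms eqxx.
- by move=> y; rewrite inE ms; case: eqP.
Qed.

(* Posa's rotation. *)
Lemma hpath_del_rotate v a s1 c s2 :
  hpath_del v (a :: s1 ++ c :: s2) -> E a c ->
  hpath_del v (rev (a :: s1) ++ c :: s2).
Proof.
move=> [es Us ms] ac.
have pe : perm_eq (rev (a :: s1) ++ c :: s2) (a :: s1 ++ c :: s2).
  by rewrite -cat_cons perm_cat2r perm_rev.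
split; last 2 first.
- by rewrite (perm_uniq pe).
- by move=> y; rewrite (perm_mem pe) ms.
move: es; rewrite /= cat_path /= => /and3P[es1 _ es2].
rewrite rev_cons cat_rcons.
have : sorted E (rev (a :: s1)) by rewrite (sorted_rev (@edge_sym G)).
rewrite rev_cons -cats1; case: (rev s1) => [_|b q] /=; first by rewrite ac es2.
by rewrite !cat_path /= => /and3P[-> -> _]; rewrite ac es2.
Qed.

Lemma hpath_del_rev v s : hpath_del v s -> hpath_del v (rev s).
Proof.
move=> [es Us ms]; split.
- by rewrite (sorted_rev (@edge_sym G)).
- by rewrite rev_uniq.
- by move=> y; rewrite mem_rev ms.
Qed.

(** On a hamiltonian path of [G - h] the vertex [a] is not alone, because of [x], so it has a
    neighbour there. *)
Lemma platypus_second_neighbour a h x :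
  a != h -> x != a -> h != x -> exists2 c, E a c & c != h.
Proof.
move=> ah xa hx; have [q [eq _ mq]] := platypus_path h.
have [|||c] := @sorted_has_neighbour _ _ (@edge_sym G) q a x eq; rewrite ?mq //.
  by rewrite eq_sym.
by move=> cq ac; exists c; rewrite // -mq.
Qed.

(** * Vertices with at most two nonneighbours *)

Section LargeDegree.
Variable x : G.
Definition nonneighbours := [set y | (y != x) && ~~ E x y].
Hypothesis few : #|nonneighbours| <= 2.

Lemma nonneighbours_eq a b c :
  a \in nonneighbours -> b \in nonneighbours -> c \in nonneighbours ->
  b != a -> c != a -> b = c.
Proof.
move=> aN bN cN ba ca; apply/eqP; apply: contraLR few => bc; rewrite -ltnNge.
have: uniq [:: a; b; c] by rewrite /= !inE negb_or eq_sym ba eq_sym ca bc.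
move=> /card_uniqP /= <-; apply: subset_leq_card; apply/subsetP => y.
by rewrite !inE => /or3P[]/eqP->; move: aN bN cN; rewrite !inE.
Qed.

(** Rotating at a neighbour [y] of [a] other than the successor of [a] makes the predecessor of [y]
    an end, while the other end stays adjacent to [x]. So that predecessor is a nonneighbour of [x]
    other than [a]; only one such vertex exists, and it determines [y]. *)
Lemma hpath_del_end_neighbours a t :
  hpath_del x (a :: t) -> E x (last a t) ->
  exists s1 b c s2, [/\ t = s1 ++ b :: c :: s2, b \in nonneighbours, b != a,
    E a c & forall y, E a y -> y != head a t -> y = c].
Proof.
move=> hs xz.
have xa : ~~ E x a by apply: contraL xz; exact: hpath_del_ends.
have [es Us ms] := hs.
have ax : a != x by rewrite -ms inE eqxx.
have aN : a \in nonneighbours by rewrite inE ax.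
have at_ : a \notin t by move: Us => /= /andP[].
have split_nbr y : E a y -> y != head a t ->
    exists s1 b s2, [/\ t = s1 ++ b :: y :: s2, b \in nonneighbours & b != a].
  move=> ay yh.
  have yt : y \in t.
    have: y \in a :: t by rewrite ms; apply: contraNneq xa => <-; rewrite edge_sym.
    by rewrite inE => /predU1P[ya|//]; rewrite ya edge_irrefl in ay.
  case/splitPr: yt hs xz yh at_ {es Us ms} => s1 s2.
  case/lastP: s1 => [|s1 b] hs xz yh at_; first by rewrite eqxx in yh.
  exists s1, b, s2; rewrite cat_rcons; split=> //.
    have [_ _ ms] := hs.
    have := hpath_del_rotate hs ay; rewrite -rcons_cons rev_rcons /=.
    move=> /hpath_del_ends H; rewrite inE -ms inE mem_cat mem_rcons inE eqxx !orbT /=.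
    apply: contraL xz => /H; rewrite !last_cat /=; exact.
  by apply: contraNneq at_ => <-; rewrite mem_cat mem_rcons inE eqxx.
have [c ac ch] : exists2 c, E a c & c != head a t.
  have tx : t != [::] by case: (t) xz => //; rewrite (negPf xa).
  apply: (platypus_second_neighbour (x := x)); [|by rewrite eq_sym|].
    by case: (t) at_ tx => //= h t'; rewrite inE negb_or => /andP[].
  by rewrite -ms; case: (t) tx => //= h t' _; rewrite !inE eqxx orbT.
have [s1 [b [s2 [Et bN ba]]]] := split_nbr c ac ch.
exists s1, b, c, s2; split=> // y ay yh.
have [s1' [b' [s2' [Et' bN' ba']]]] := split_nbr y ay yh.
have Ut : uniq t by move: Us => /= /andP[].
rewrite (nonneighbours_eq aN bN bN' ba ba') in Et.
by rewrite (uniq_succ Ut Et Et').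
Qed.

Lemma hpath_del_last_nonadjacent a t : hpath_del x (a :: t) -> ~~ E x (last a t).
Proof.
move=> hs; apply/negP => xz.
have xa : ~~ E x a by apply: contraL xz; exact: hpath_del_ends.
have [s1 [b [c [s2 [Et bN ba ac aH]]]]] := hpath_del_end_neighbours hs xz.
(* The rotated path starts at [b] and keeps its last vertex, so the same analysis applies to [b],
   with [a] as the second nonneighbour and again [c] as its successor. *)
have := hs; rewrite {1}Et -cat_rcons => /hpath_del_rotate -/(_ ac).
rewrite -rcons_cons rev_rcons rev_cons cat_cons cat_rcons => hs'.
have xz' : E x (last b (rev s1 ++ a :: c :: s2)).
  by move: xz; rewrite Et !last_cat.
have [r1 [a' [c' [r2 [Et' aN' ab' bc' bH]]]]] := hpath_del_end_neighbours hs' xz'.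
have [_ Us ms] := hs; have [_ Us' _] := hs'.
have aN : a \in nonneighbours by rewrite inE xa andbT -ms inE eqxx.
have aa' : a' = a by apply: (nonneighbours_eq bN) => //; rewrite eq_sym.
have cc' : c' = c.
  have Ut : uniq (rev s1 ++ a :: c :: s2) by move: Us' => /= /andP[].
  by rewrite aa' in Et'; rewrite (uniq_succ Ut Et' erefl).
rewrite {}cc' {Et'} in bc' bH.
(* Besides [c], each of [a] and [b] has at most one neighbour, so both are ends of [q]; but both are
   adjacent to [c], against [hpath_del_ends]. *)
have [q [eq Uq mq]] := platypus_path c.
have aq : a \in q by rewrite mq; apply: contraTneq ac => <-; rewrite edge_irrefl.
have bq : b \in q by rewrite mq; apply: contraTneq bc' => <-; rewrite edge_irrefl.
have leaf u h : u \in q -> (forall y, E u y -> y != h -> y = c) ->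
    exists q', q = u :: q' \/ q = rcons q' u.
  move=> uq uH; apply: (sorted_leaf_end (@edge_sym G) eq Uq uq) => y y' yq yq' uy uy'.
  have H r : r \in q -> E u r -> r = h.
    by move=> rq ur; apply/eqP; apply: contraTT rq => rh; rewrite mq (uH r ur rh) eqxx.
  by rewrite (H y yq uy) (H y' yq' uy').
have [ca cb] : E c a /\ E c b by rewrite !(edge_sym c).
have [qa Ea] := leaf a _ aq aH; have [qb Eb] := leaf b _ bq bH.
have nab u v q1 q2 : E c u -> E c v -> q = u :: q1 -> q = rcons q2 v -> u != v -> False.
  move=> cu cv E1 E2 uv; have hq : hpath_del c (u :: q1) by rewrite -E1.
  have /= := hpath_del_ends hq cu; rewrite -[last u q1]/(last u (u :: q1)) -E1 E2 last_rcons.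
  by rewrite cv.
case: Ea => Ea; case: Eb => Eb.
- by move: ba; rewrite Ea in Eb; case: Eb => ->; rewrite eqxx.
- by apply: nab Ea Eb _; rewrite // eq_sym.
- by apply: nab Eb Ea _.
- by move: ba; rewrite Ea in Eb; case/rcons_inj: Eb => _ ->; rewrite eqxx.
Qed.

Lemma hpath_del_head_nonadjacent a t : hpath_del x (a :: t) -> ~~ E x a.
Proof.
move=> /hpath_del_rev; rewrite rev_cons; case: (rev t) => [|b r] /=.
  exact: (@hpath_del_last_nonadjacent a [::]).
by move/hpath_del_last_nonadjacent; rewrite last_rcons.
Qed.

(** Both ends of every hamiltonian path of [G - x] are now nonneighbours of [x]. A rotation at [a]
    turns [b] into an end, and [b] differs from the old ends [a] and [z]: it comes before [c] on the
    path, [z] does not. *)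
Lemma few_nonneighbours_absurd : False.
Proof.
have [n3 _ _] := platG.
have cover (r : seq G) : (forall y, y \in r) -> 2 < size r.
  by move=> mr; apply: leq_trans n3 (leq_trans _ (card_size r)); apply/subset_leq_card/subsetP.
have [[|a t] hs] := platypus_path x; have [_ Us ms] := hs.
  suff: 2 < size [:: x] by [].
  by apply: cover => y; have := ms y; rewrite !inE; case: eqP.
have xa := hpath_del_head_nonadjacent hs; have xz := hpath_del_last_nonadjacent hs.
have ax : a != x by rewrite -ms inE eqxx.
have at_ : a \notin t by move: Us => /= /andP[].
have tx : t != [::].
  apply/eqP => t0; suff: 2 < size [:: a; x] by []; apply: cover => y.
  by have := ms y; rewrite t0 !inE; case: (y == x); rewrite ?orbT // orbF.
have [c ac ch] : exists2 c, E a c & c != head a t.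
  apply: (platypus_second_neighbour (x := x)); [|by rewrite eq_sym|].
    by case: (t) at_ tx => //= h t'; rewrite inE negb_or => /andP[].
  by rewrite -ms; case: (t) tx => //= h t' _; rewrite !inE eqxx orbT.
have ct : c \in t.
  have: c \in a :: t by rewrite ms; apply: contraNneq xa => <-; rewrite edge_sym.
  by rewrite inE => /predU1P[ya|//]; rewrite ya edge_irrefl in ac.
case/splitPr: ct hs Us ms xz ch => s1 s2; case/lastP: s1 => [|s1 b] hs Us ms xz ch.
  by rewrite eqxx in ch.
have := hpath_del_rotate hs ac; rewrite -rcons_cons rev_rcons cat_cons.
move=> /hpath_del_head_nonadjacent xb; set z := last _ _ in xz.
have zs : z \in c :: s2 by rewrite /z last_cat /= mem_last.
have bs : b \in rcons s1 b by rewrite mem_rcons inE eqxx.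
move: Us; rewrite cons_uniq cat_uniq mem_cat => /andP[/norP[a1 a2] /and3P[_ /hasPn ns _]].
have bz : b = z.
  apply: (@nonneighbours_eq a); rewrite ?inE ?xa ?xb ?xz ?andbT // -?ms ?inE ?eqxx //.
  - by rewrite mem_cat bs orbT.
  - by rewrite mem_cat zs !orbT.
  - by apply: contraNneq a1 => <-.
  - by apply: contraNneq a2 => <-.
by have := ns z zs; rewrite -bz bs.
Qed.

End LargeDegree.

End PlatypusPaths.

Lemma card_nonneighbours (G : sgraph) (x : G) :
  #|nonneighbours x| + degree x + 1 = order_of G.
Proof.
rewrite addn1 /order_of -cardsT (cardsD1 x [set: G]) inE add1n; congr _.+1.
rewrite -(cardsID (nbhd x) ([set: G] :\ x)) addnC /degree.
congr (_ + _); apply: eq_card => y; rewrite !inE ?andbT; last by rewrite andbC.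
by case: eqP => [->|_]; rewrite ?edge_irrefl.
Qed.

Lemma max_degreeP (G : sgraph) : 0 < order_of G -> exists x : G, max_degree G = degree x.
Proof. by move=> /(eq_bigmax (@degree G))[x Ex]; exists x. Qed.

Lemma platypus_max_degree (G : sgraph) : platypus G -> max_degree G + 4 <= order_of G.
Proof.
move=> platG; have [n3 _ _] := platG.
have [x ->] := max_degreeP (ltn_trans (isT : 0 < 2) n3).
rewrite leqNgt; apply/negP => lt; apply: (few_nonneighbours_absurd platG (x := x)).
rewrite -(leq_add2r (degree x + 1)) addnA card_nonneighbours addnCA addnC -ltnS.
by move: lt; rewrite !addnS addn0.
Qed.

(** * The search *)

(* [vm_compute] is call-by-value, so that [has], [all], [&&] and [||] would
   explore every branch; conditionals do not. *)
Section LazyQuantifiers.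
Variables (T : Type) (a : pred T).
Fixpoint has_lazy (s : seq T) :=
  if s is x :: s' then if a x then true else has_lazy s' else false.
Fixpoint all_lazy (s : seq T) :=
  if s is x :: s' then if a x then all_lazy s' else false else true.
Lemma has_lazyE s : has_lazy s = has a s. Proof. by []. Qed.
Lemma all_lazyE s : all_lazy s = all a s. Proof. by []. Qed.
End LazyQuantifiers.

Fixpoint path_search (e : rel nat) (P : pred nat) k x s :=
  if k is k'.+1 then
    let r := e x in
    has_lazy (fun y => if r y then path_search e P k' y (rem y s) else false) s
  else P x.

Lemma path_searchP (e : rel nat) (P : pred nat) x s :
  reflect (exists q, [/\ perm_eq q s, path e x q & P (last x q)])
          (path_search e P (size s) x s).
Proof.
move Dk: (size s) => k; elim: k => [|k IH] /= in x s Dk *.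
  case: s Dk => // _; apply: (iffP idP) => [Px|[q [/perm_nilP-> _]]] //.
  by exists [::].
rewrite has_lazyE; apply: (iffP hasP) => [[y ys]|[[|y q] [pq eq Pq]]].
- case: ifP => // xy /IH[|q [pq yq Pq]]; first by rewrite size_rem // Dk.
  exists (y :: q); rewrite /= xy; split=> //.
  by rewrite perm_sym (perm_trans (perm_to_rem ys)) // perm_cons perm_sym.
- by move: (perm_size pq); rewrite Dk.
have ys : y \in s by rewrite -(perm_mem pq) inE eqxx.
exists y => //; move: eq => /= /andP[-> yq]; apply/IH; first by rewrite size_rem // Dk.
exists q; split=> //; rewrite -(perm_cons y) (perm_trans pq) //; exact: perm_to_rem.
Qed.

(* A hamiltonian path has at most two vertices of degree less than 2. *)
Definition traceb (e : rel nat) s :=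
  if 2 < count (fun x => let r := e x in count r s < 2) s then false
  else has_lazy (fun x => path_search e predT (size s).-1 x (rem x s)) s.

(** The degree test never rejects wrongly: a vertex with fewer than two neighbours in [s] is one of
    the two ends of [q]. *)
Lemma sorted_traceb (e : rel nat) q s :
  symmetric e -> uniq s -> s != [::] -> perm_eq q s -> sorted e q -> traceb e s.
Proof.
move=> e_sym Us s0 pq eq; rewrite /traceb ifN; last first.
  rewrite -leqNgt -size_filter.
  have /= -> := @uniq_leq_size _ _ [:: head 0 q; last 0 q]; rewrite ?filter_uniq //.
  move=> x; rewrite mem_filter -(perm_mem pq) => /andP[sx xq].
  have [||b c bq cq xb xc|q' [->|->]] := @sorted_leaf_end _ e e_sym q x eq;
    rewrite ?(perm_uniq pq) //.
  - apply: contraTeq sx => bc; rewrite -leqNgt -size_filter.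
    apply: (uniq_leq_size (s1 := [:: b; c])); first by rewrite /= inE bc.
    by move=> y; rewrite !inE mem_filter -(perm_mem pq) => /pred2P[]->; apply/andP.
  - by rewrite inE eqxx.
  - by rewrite last_rcons !inE eqxx orbT.
rewrite has_lazyE; case: q => [|x q] in pq eq *.
  by rewrite perm_sym in pq; rewrite (perm_nilP pq) in s0.
have xs : x \in s by rewrite -(perm_mem pq) inE eqxx.
apply/hasP; exists x; rewrite // -(size_rem xs); apply/path_searchP; exists q; split=> //.
rewrite -(perm_cons x) (perm_trans pq) //; exact: perm_to_rem.
Qed.

Lemma traceb_sorted (e : rel nat) s :
  traceb e s -> exists2 q, perm_eq q s & sorted e q.
Proof.
rewrite /traceb; case: ifP => // _; rewrite has_lazyE => /hasP[x xs].
rewrite -(size_rem xs) => /path_searchP[q [pq xq _]]; exists (x :: q) => //.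
by rewrite perm_sym (perm_trans (perm_to_rem xs)) // perm_cons perm_sym.
Qed.

(** The row is bound before [j] so that a partial application [e x] looks it up only once. *)
Definition rel_of (t : seq (seq bool)) : rel nat :=
  fun i => let r := nth [::] t i in fun j => nth false r j.
Definition add_arc t i j := set_nth [::] t i (set_nth false (nth [::] t i) j true).
Definition add_edge t (p : nat * nat) := add_arc (add_arc t p.1 p.2) p.2 p.1.
Definition add_edges := foldl add_edge.

Lemma rel_of_add_arc t i j u v :
  rel_of (add_arc t i j) u v = rel_of t u v || ((u, v) == (i, j)).
Proof.
rewrite /rel_of nth_set_nth /= xpair_eqE; case: eqP => [->|_]; last by rewrite orbF.
by rewrite nth_set_nth /=; case: eqP; rewrite ?orbT ?orbF.
Qed.

Lemma rel_of_add_edges t es u v :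
  rel_of (add_edges t es) u v =
  [|| rel_of t u v, (u, v) \in es | (v, u) \in es].
Proof.
elim: es t => [|p es IH] t /=; first by rewrite orbF.
rewrite IH !rel_of_add_arc !inE -!orbA; case: p => i j /=; rewrite !xpair_eqE.
by rewrite [(u == j) && _]andbC; do ?bool_congr.
Qed.

(** * The backtracking search and its soundness *)

Section Search.
Variables (n d : nat) (final : seq (seq bool) -> bool).
Let V := iota 0 n.

Definition ham_join (e : rel nat) a b :=
  let s := rem a V in path_search e (pred1 b) (size s) a s.

Definition admissible (e : rel nat) (p : nat * nat) :=
  if e p.1 p.2 then false else
  if count (e p.1) V < d then
    if count (e p.2) V < d then ~~ ham_join e p.1 p.2 else false
  else false.

(* Branching at a vertex with few possible neighbours keeps the tree small;
   soundness does not depend on the choice. *)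
Definition pick_edge (deg : seq nat) es :=
  foldr (fun p q => if minn (nth 0 deg p.1) (nth 0 deg p.2) <=
                       minn (nth 0 deg q.1) (nth 0 deg q.2) then p else q)
        (head (0, 0) es) es.

(* [t] is the adjacency matrix of the edges already chosen and [es] lists the
   undecided ones; [k] is fuel, and running out of it counts as failure. *)
Fixpoint search k t es :=
  if k is k'.+1 then
    let es' := filter (admissible (rel_of t)) es in
    let z := rel_of (add_edges t es') in
    if all_lazy (fun w => traceb z (rem w V)) V then
      if nilp es' then final t else
      let p := pick_edge [seq count (z v) V | v <- V] es' in
      let es'' := filter (predC1 p) es' in
      if search k' (add_edge t p) es'' then search k' t es'' else false
    else true
  else false.

Section Soundness.
Variables (e : rel nat) (C : Prop).
Hypotheses (n2 : 1 < n) (e_sym : symmetric e).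
Hypothesis e_cycle : forall c, perm_eq c V -> ~~ cycle e c.
Hypothesis e_trace : forall w, w < n -> exists2 q, perm_eq q (rem w V) & sorted e q.
Hypothesis e_deg : forall v, v < n -> count (e v) V <= d.
Hypothesis e_final : forall t, final t ->
  (forall u v, u < n -> v < n -> e u v = rel_of t u v) -> C.

Let mem_V v : (v \in V) = (v < n). Proof. by rewrite mem_iota. Qed.
Let uniq_V : uniq V. Proof. exact: iota_uniq. Qed.

(** If an edge of [e] is not yet chosen, both its ends have smaller degree in [y] than in [e], and a
    hamiltonian path of chosen edges between them would close to a cycle of [e]. *)
Lemma inadmissible_edge (y : rel nat) p :
  symmetric y -> subrel y e -> p.1 < n -> p.2 < n -> ~~ admissible y p ->
  e p.1 p.2 -> y p.1 p.2.
Proof.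
case: p => a b /= y_sym ye an bn; rewrite /admissible /=; case yab: (y a b) => //.
have deg u v : u < n -> v < n -> e u v -> y u v = false -> count (y u) V < d.
  move=> un vn euv yuv; apply: leq_trans (e_deg un).
  rewrite -!size_filter; have: size (v :: filter (y u) V) <= size (filter (e u) V).
    apply: uniq_leq_size; first by rewrite /= mem_filter yuv filter_uniq.
    by move=> w; rewrite inE !mem_filter => /predU1P[->|/andP[/ye-> ->]//]; rewrite euv mem_V.
  by [].
move=> adm eab; rewrite (deg a b) // (deg b a) // 1?e_sym // 1?y_sym // negbK in adm.
case/path_searchP: adm => q [pq aq /eqP bq].
have /e_cycle/negP[] : perm_eq (a :: q) V.
  have aV : a \in V by rewrite mem_V.
  by rewrite perm_sym (perm_trans (perm_to_rem aV)) // perm_cons perm_sym.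
by rewrite /= rcons_path (sub_path ye aq) bq e_sym.
Qed.

(** Invariant: chosen edges lie in [e], and every edge of [e] is chosen or undecided. The conclusion
    [C] is left open: with a [final] that rejects everything, a successful search refutes the
    existence of [e]. *)
Lemma searchP k t es :
  search k t es -> symmetric (rel_of t) -> subrel (rel_of t) e ->
  (forall u v, u < n -> v < n -> e u v -> [|| rel_of t u v, (u, v) \in es | (v, u) \in es]) ->
  C.
Proof.
elim: k t es => //= k IH t es; rewrite all_lazyE.
set y := rel_of t; set es' := filter _ _; set z := rel_of _ => + y_sym ye cov.
have cov' u v : u < n -> v < n -> e u v -> [|| y u v, (u, v) \in es' | (v, u) \in es'].
  move=> un vn euv; apply: contraTT (euv); rewrite !negb_or !mem_filter !negb_and.
  case/and3P=> yuv a1 a2; apply: contraT; rewrite negbK => _.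
  have evu : e v u by rewrite e_sym.
  have := cov u v un vn euv; rewrite (negPf yuv) /= => /orP[es_|es_].
    move: a1; rewrite es_ orbF => /(inadmissible_edge (p := (u, v)) y_sym ye un vn)/(_ euv) /=.
    by rewrite (negPf yuv).
  move: a2; rewrite es_ orbF => /(inadmissible_edge (p := (v, u)) y_sym ye vn un)/(_ evu) /=.
  by rewrite y_sym (negPf yuv).
have z_sym : symmetric z.
  by move=> u v; rewrite /z !rel_of_add_edges -/y y_sym orbCA orbC orbA orbAC.
(* On [V] the relation [z] contains [e], so the paths given by [e_trace] survive and this branch is
   not pruned. *)
have -> : all (fun w => traceb z (rem w V)) V.
  apply/allP => w wV; have [q pq eq] := e_trace (etrans (esym (mem_V w)) wV).
  apply: (sorted_traceb z_sym _ _ pq); first exact: rem_uniq.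
    by rewrite -size_eq0 size_rem // size_iota -lt0n -ltnS prednK // ltnW.
  have qn : all (fun u => u < n) q.
    by apply/allP => u; rewrite (perm_mem pq) => /mem_rem; rewrite mem_V.
  apply: (@sub_in_sorted _ (fun u => u < n) e) qn eq => u v un vn /(cov' u v un vn).
  by rewrite /z rel_of_add_edges.
case: ifP => [/nilP es0 /e_final|_]; last set p := pick_edge _ _.
  apply=> u v un vn; apply/idP/idP => [/(cov' u v un vn)|/ye//].
  by rewrite es0 orbF.
set es'' := filter _ _; case: ifP => // s1 s2.
(* Only the branch that agrees with [e] about [p] is followed; it keeps the invariant. *)
case ep: (e p.1 p.2) s1 => s1.
  apply: IH s1 _ _ _.
  - move=> u v; rewrite -![rel_of _]/(rel_of (add_edges t [:: p])).
    by rewrite !rel_of_add_edges -/y y_sym orbCA orbC orbA orbAC.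
  - move=> u v; rewrite -[rel_of _]/(rel_of (add_edges t [:: p])) rel_of_add_edges !inE.
    by case/or3P=> [/ye //|/eqP Ep|/eqP Ep]; rewrite -Ep /= in ep; rewrite // e_sym.
  - move=> u v un vn euv; rewrite -[rel_of _]/(rel_of (add_edges t [:: p])) rel_of_add_edges !inE.
    have := cov' u v un vn euv; rewrite -/y !mem_filter /=.
    by case: (y u v); case: ((u, v) == p); case: ((v, u) == p).
apply: IH s2 y_sym ye _ => u v un vn euv; have := cov' u v un vn euv.
rewrite -/y !mem_filter /=.
have -> : ((u, v) == p) = false by apply: contraTF euv => /eqP Ep; rewrite -Ep /= in ep; rewrite ep.
have -> // : ((v, u) == p) = false.
by apply: contraTF euv => /eqP Ep; rewrite -Ep /= in ep; rewrite e_sym ep.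
Qed.

End Soundness.
End Search.

(** * Starting positions of the search *)

Section FromPath.
Variable n : nat.

Definition path_edges := [seq (i, i.+1) | i <- iota 1 (n - 2)].
(** Vertex 0 does not occur: its row is fixed before the search begins. *)
Definition other_edges := [seq (i, j) | i <- iota 1 n.-1, j <- iota i.+2 (n - i.+2)].

Fixpoint masks k :=
  if k is k'.+1 then [seq b :: m | b <- [:: true; false], m <- masks k'] else [:: [::]].

Lemma mem_masks m : m \in masks (size m).
Proof.
by elim: m => //= b m IH; rewrite cats0 mem_cat; apply/orP; case: b; [left|right]; exact: map_f.
Qed.

(* [m] is the row of vertex 0, without its diagonal entry. *)
Definition search_from final (m : seq bool) :=
  let d := count id m in
  if n < d + 4 then true else
  if head false m then true else
  search n d final (n * n)
    (add_edges [::] ([seq (0, i) | i <- mask m (iota 1 n.-1)] ++ path_edges))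
    other_edges.

Definition search_all final := all_lazy (search_from final) (masks n.-1).

Variables (final : seq (seq bool) -> bool) (e : rel nat) (C : Prop).
Let V := iota 0 n.
Hypotheses (n2 : 1 < n) (e_sym : symmetric e) (e_irr : irreflexive e).
Hypothesis e_cycle : forall c, perm_eq c V -> ~~ cycle e c.
Hypothesis e_trace : forall w, w < n -> exists2 q, perm_eq q (rem w V) & sorted e q.
Hypothesis e_path : forall i, 0 < i -> i.+1 < n -> e i i.+1.
Hypothesis e_01 : ~~ e 0 1.
Hypothesis e_deg0 : count (e 0) V + 4 <= n.
Hypothesis e_deg : forall v, v < n -> count (e v) V <= count (e 0) V.
Hypothesis e_final : forall t, final t ->
  (forall u v, u < n -> v < n -> e u v = rel_of t u v) -> C.

(** The search is entered with the actual row of vertex 0. The rows skipped by [search_from] are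
    ruled out by [e_deg0], the degree bound, and by [e_01], which orients the path. *)
Lemma search_allP : search_all final -> C.
Proof.
pose m := map (e 0) (iota 1 n.-1).
have szm : size m = n.-1 by rewrite size_map size_iota.
rewrite /search_all all_lazyE => /allP/(_ m); rewrite -szm mem_masks => /(_ isT).
have dm : count id m = count (e 0) V.
  have -> : V = 0 :: iota 1 n.-1 by rewrite /V -{1}(ltn_predK n2).
  by rewrite count_map /= e_irr.
rewrite /search_from dm ltnNge e_deg0 /=.
have -> : head false m = false.
  by rewrite /m; case: (n) n2 => [|[|n']] // _; rewrite /= (negPf e_01).
rewrite -filter_mask => /searchP; apply.
- exact: n2.
- exact: e_sym.
- exact: e_cycle.
- exact: e_trace.
- exact: e_deg.
- exact: e_final.
- move=> u v; rewrite !rel_of_add_edges /rel_of !nth_nil /=; exact: orbC.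
- move=> u v; rewrite rel_of_add_edges /rel_of !nth_nil /=.
  have sub w w' : (w, w') \in [seq (0, i) | i <- iota 1 n.-1 & e 0 i] ++ path_edges -> e w w'.
    rewrite mem_cat => /orP[/mapP[i]|/mapP[i]].
      by rewrite mem_filter => /andP[ei _] [-> ->].
    rewrite mem_iota => /andP[i0 ilt] [-> ->]; apply: e_path => //.
    by move: ilt; rewrite addnBA // add1n subSS subn1 ltn_predRL.
  by case/orP=> /sub //; rewrite e_sym.
- have cov u v : u < v -> v < n -> e u v ->
      ((u, v) \in [seq (0, i) | i <- iota 1 n.-1 & e 0 i] ++ path_edges) ||
      ((u, v) \in other_edges).
    move=> uv vn euv; rewrite mem_cat; case: u => [|u] in uv euv *.
      apply/orP; left; apply/orP; left; apply/mapP; exists v => //.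
      by rewrite mem_filter euv mem_iota uv add1n prednK // ltnW.
    have [vE|vN] := eqVneq v u.+2.
      apply/orP; left; apply/orP; right; apply/mapP; exists u.+1; last by rewrite vE.
      by rewrite mem_iota /= addnBA // add1n subSS subn1 ltn_predRL -vE.
    apply/orP; right; apply/allpairsPdep; exists u.+1, v; split=> //.
      by rewrite mem_iota /= add1n prednK ?(ltn_trans uv) // ltnW.
    have uv' : u.+2 < v by rewrite ltn_neqAle eq_sym vN.
    by rewrite mem_iota uv' subnKC // (leq_trans uv') // ltnW.
  move=> u v un vn euv; rewrite rel_of_add_edges /rel_of !nth_nil /=.
  have [uv|vu|uv] := ltngtP u v; last by rewrite uv e_irr in euv.
    by case/orP: (cov u v uv vn euv) => ->; rewrite ?orbT.
  by rewrite e_sym in euv; case/orP: (cov v u vu un euv) => ->; rewrite ?orbT.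
Qed.

End FromPath.

(** The edge lists below name each edge once and may contain a loop; this turns them into simple
    graphs. *)
Definition symm (e : rel nat) : rel nat :=
  fun i j => if i == j then false else if e i j then true else e j i.

Lemma symm_sym e : symmetric (symm e).
Proof. by move=> i j; rewrite /symm eq_sym; case: eqP => // _; case: (e i j); case: (e j i). Qed.

Lemma symm_irr e : irreflexive (symm e).
Proof. by move=> i; rewrite /symm eqxx. Qed.

(** [im] lists the images of the first [size im] vertices and [s] the targets still free; each new
    vertex is compared with the earlier ones only. *)
Fixpoint extend_iso (e1 e2 : rel nat) k (im s : seq nat) :=
  if k is k'.+1 then
    has_lazy (fun y =>
      if all_lazy (fun j => e1 (size im) j == e2 y (nth 0 im j)) (iota 0 (size im))
      then extend_iso e1 e2 k' (rcons im y) (rem y s) else false) s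
  else true.

Lemma extend_isoP (e1 e2 : rel nat) im s :
  symmetric e1 -> symmetric e2 -> irreflexive e1 -> irreflexive e2 ->
  extend_iso e1 e2 (size s) im s ->
  (forall i j, i < size im -> j < size im -> e1 i j = e2 (nth 0 im i) (nth 0 im j)) ->
  exists2 q, perm_eq q (im ++ s) &
    forall i j, i < size q -> j < size q -> e1 i j = e2 (nth 0 q i) (nth 0 q j).
Proof.
move=> sym1 sym2 irr1 irr2; move Dk: (size s) => k; elim: k => [|k IH] /= in im s Dk *.
  by case: s Dk => // _ _ imP; exists im; rewrite ?cats0.
rewrite has_lazyE => /hasP[y ys]; case: ifP => // /allP adj /IH{}IH imP.
have [|i j|q pq qP] := IH; first by rewrite size_rem // Dk.
  rewrite size_rcons !ltnS !nth_rcons [i <= _]leq_eqVlt [j <= _]leq_eqVlt.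
  have adj' l : l < size im -> e1 (size im) l = e2 y (nth 0 im l).
    by move=> ll; apply/eqP/adj; rewrite mem_iota.
  case/predU1P=> [->|il]; case/predU1P=> [->|jl]; rewrite ?ltnn ?eqxx ?il ?jl.
  - by rewrite irr1 irr2.
  - exact: adj'.
  - by rewrite sym1 sym2 adj'.
  - exact: imP.
exists q; rewrite // (perm_trans pq) // cat_rcons perm_cat2l perm_sym.
exact: perm_to_rem.
Qed.

(** * Concrete graphs on initial segments of the natural numbers *)

Section GraphOn.
Variables (n : nat) (e : rel nat).
Definition graph_edge (i j : 'I_n) := symm e i j.
Lemma graph_edge_sym : symmetric graph_edge.
Proof. by move=> i j; exact: symm_sym. Qed.
Lemma graph_edge_irr : irreflexive graph_edge.
Proof. by move=> i; exact: symm_irr. Qed.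
Definition graph_on : sgraph := SGraph graph_edge_sym graph_edge_irr.

Lemma order_graph_on : order_of graph_on = n.
Proof. exact: card_ord. Qed.

Lemma degree_graph_on (i : graph_on) : degree i = count (symm e (i : 'I_n)) (iota 0 n).
Proof.
rewrite -val_enum_ord count_map -size_filter; set s := filter _ _.
have /card_uniqP <- : uniq s by rewrite filter_uniq ?enum_uniq.
by apply: eq_card => j; rewrite inE mem_filter mem_enum andbT.
Qed.

Lemma platypus_graph_on :
  2 < n ->
  (forall c, perm_eq c (iota 0 n) -> ~~ cycle (symm e) c) ->
  (forall w, w < n -> exists2 q, perm_eq q (rem w (iota 0 n)) & sorted (symm e) q) ->
  platypus graph_on.
Proof.
move=> n3 e_cycle e_trace; split; first by rewrite order_graph_on.
  case=> c [_ cc Uc mc].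
  have /e_cycle/negP[] : perm_eq (map val c) (iota 0 n).
    rewrite -val_enum_ord; apply: perm_map; apply: uniq_perm; rewrite ?enum_uniq //.
    by move=> i; rewrite mc mem_enum.
  by rewrite cycle_map.
move=> v; apply/traceable_deleteP.
have [q pq eq] := e_trace _ (ltn_ord v).
have Uq : uniq q by rewrite (perm_uniq pq) rem_uniq ?iota_uniq.
have mq i : (i \in q) = (i != v) && (i < n).
  by rewrite (perm_mem pq) mem_rem_uniq ?iota_uniq // inE mem_iota.
have Eq : map val (pmap insub q : seq 'I_n) = q.
  rewrite pmap_filter; last exact: insubK.
  by apply/all_filterP/allP => i; rewrite mq => /andP[_ ?]; rewrite /= insubT.
exists (pmap insub q : seq 'I_n); split.
- rewrite -size_eq0 -(size_map val) Eq (perm_size pq) size_rem ?mem_iota ?ltn_ord //.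
  by rewrite size_iota -lt0n -ltnS prednK ltnW // ltnW.
- by move: eq; rewrite -{1}Eq sorted_map.
- by rewrite -(map_inj_uniq val_inj) Eq.
- by move=> y; rewrite -(mem_map val_inj) Eq mq ltn_ord andbT.
Qed.

End GraphOn.

(** * Platypuses of order at most 9 *)

Definition edge_list (l : seq (nat * nat)) : rel nat := fun u v => (u, v) \in l.

(** The triangles are 012 and 345, and the connecting paths run through 6, 7 and 8; the last list
    holds the edges joining the ends of these paths. *)
Definition nine_rel k := edge_list
  ([:: (0, 1); (0, 2); (1, 2); (3, 4); (3, 5); (4, 5);
       (0, 6); (3, 6); (1, 7); (4, 7); (2, 8); (5, 8)]
   ++ take k [:: (0, 3); (1, 4); (2, 5)]).

Definition nine k := graph_on 9 (nine_rel k).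

Definition no_ham_cycle n (e : rel nat) :=
  let s := iota 1 n.-1 in ~~ path_search e (fun x => e x 0) (size s) 0 s.

(** Every hamiltonian cycle can be rotated to start at 0, the only start searched. *)
Lemma no_ham_cycleP n (e : rel nat) c :
  no_ham_cycle n e -> perm_eq c (iota 0 n) -> 0 < n -> ~~ cycle e c.
Proof.
move=> + pc n0; apply: contraL => cc; rewrite negbK; apply/path_searchP.
have c0 : 0 \in c by rewrite (perm_mem pc) mem_iota.
have [i q Ec] := rot_to c0; exists q.
move: cc; rewrite -(rot_cycle i) Ec /= rcons_path => /andP[-> ->]; split=> //.
rewrite -(perm_cons 0) -Ec perm_rot (perm_trans pc) //.
by rewrite -{1}(ltn_predK n0).
Qed.

Definition all_traceb n (e : rel nat) :=
  all_lazy (fun w => traceb e (rem w (iota 0 n))) (iota 0 n).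

Lemma all_tracebP n (e : rel nat) w :
  all_traceb n e -> w < n -> exists2 q, perm_eq q (rem w (iota 0 n)) & sorted e q.
Proof.
rewrite /all_traceb all_lazyE => /allP H wn; apply: traceb_sorted; apply: H.
by rewrite mem_iota.
Qed.

Lemma platypus_nine k : k < 4 -> platypus (nine k).
Proof.
have: all (fun k => no_ham_cycle 9 (symm (nine_rel k)) &&
                    all_traceb 9 (symm (nine_rel k))) (iota 0 4).
  by vm_compute.
move=> /allP H k4; have /H/andP[nh tr] : k \in iota 0 4 by rewrite mem_iota.
apply: platypus_graph_on => // [c pc|w w9]; first exact: no_ham_cycleP nh pc _.
exact: all_tracebP tr w9.
Qed.

Definition is_nine (t : seq (seq bool)) :=
  has_lazy (fun k => extend_iso (symm (rel_of t)) (symm (nine_rel k)) 9 [::] (iota 0 9))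
           (iota 0 4).

(** As [xpred0] accepts no completed graph, success means that every branch is pruned. *)
Lemma no_platypus_search n : 2 < n < 9 -> search_all n xpred0.
Proof.
have: all (fun n => search_all n xpred0) (iota 3 6) by vm_compute.
by move=> /allP H n39; apply: H; rewrite mem_iota.
Qed.

Lemma nine_search : search_all 9 is_nine.
Proof. by vm_compute. Qed.

(** * Numbering the vertices of a graph *)

Section Labelling.
Variables (G : sgraph) (x : G) (r : seq G).
Hypotheses (Ur : uniq r) (mr : forall y, y \in r).
Let n := size r.

(** Numbers beyond the list denote [x], so symmetry and irreflexivity hold for all numbers. *)
Definition label_rel : rel nat := fun i j => edge (nth x r i) (nth x r j).

Lemma size_labelling : n = order_of G.
Proof. by rewrite /n -(card_uniqP Ur); apply: eq_card => y; rewrite mr. Qed.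

Lemma label_rel_sym : symmetric label_rel.
Proof. by move=> i j; exact: edge_sym. Qed.

Lemma label_rel_irr : irreflexive label_rel.
Proof. by move=> i; exact: edge_irrefl. Qed.

Lemma label_rel_degree i : count (label_rel i) (iota 0 n) = degree (nth x r i).
Proof.
rewrite -[LHS](count_map (nth x r) (edge (nth x r i))) map_nth_iota0 // take_size.
rewrite -size_filter; set s := filter _ _.
have /card_uniqP <- : uniq s by rewrite filter_uniq.
by apply: eq_card => y; rewrite mem_filter mr andbT inE.
Qed.

Lemma label_rel_cycle c : platypus G -> perm_eq c (iota 0 n) -> ~~ cycle label_rel c.
Proof.
move=> platG pc; apply/negP => cc.
have pr : perm_eq (map (nth x r) c) r.
  by rewrite (perm_trans (perm_map _ pc)) // map_nth_iota0 // take_size.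
apply: (platypus_no_cycle platG (c := map (nth x r) c)); first by rewrite cycle_map.
  by rewrite (perm_uniq pr).
by move=> y; rewrite (perm_mem pr) mr.
Qed.

Lemma label_rel_trace w : platypus G -> w < n ->
  exists2 q, perm_eq q (rem w (iota 0 n)) & sorted label_rel q.
Proof.
move=> platG wn; have [q [eq Uq mq]] := platypus_path platG (nth x r w).
exists (map (index^~ r) q).
  apply: uniq_perm; rewrite ?rem_uniq ?iota_uniq //.
    rewrite map_inj_in_uniq // => y z _ _ Eyz.
    by rewrite -(nth_index x (mr y)) Eyz nth_index.
  move=> i; rewrite mem_rem_uniq ?iota_uniq // !inE mem_iota /= add0n.
  apply/mapP/andP => [[y yq ->]|[iw ltin]].
    rewrite index_mem mr; split=> //; apply: contraTneq yq => Eyw.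
    by rewrite mq -Eyw nth_index ?eqxx.
  exists (nth x r i); last by rewrite index_uniq.
  by rewrite mq nth_uniq.
rewrite sorted_map; congr is_true: eq; apply: eq_sorted => y z /=.
by rewrite /label_rel !nth_index.
Qed.

Lemma isomorphic_graph_on e q :
  perm_eq q (iota 0 n) ->
  (forall i j, i < n -> j < n -> label_rel i j = symm e (nth 0 q i) (nth 0 q j)) ->
  isomorphic G (graph_on n e).
Proof.
move=> pq qP.
have szq : size q = n by rewrite (perm_size pq) size_iota.
have ltr y : index y r < n by rewrite index_mem mr.
have ltq y : nth 0 q (index y r) < n.
  have := mem_nth 0 (_ : index y r < size q); rewrite szq => /(_ (ltr y)).
  by rewrite (perm_mem pq) mem_iota.
exists (fun y => Ordinal (ltq y)).
  apply: inj_card_bij; last by rewrite card_ord [n]size_labelling.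
  move=> y z [] /eqP; rewrite nth_uniq ?szq // ?(perm_uniq pq) ?iota_uniq // => /eqP Eyz.
  by rewrite -(nth_index x (mr y)) Eyz nth_index.
by move=> y z; rewrite /edge /= /graph_edge /= -qP // /label_rel !nth_index.
Qed.

End Labelling.

(** * Reduction of the classification to the search *)

Section Classification.
Variable G : sgraph.
Hypothesis platG : platypus G.

Lemma platypus_labelling : exists (x : G) (s : seq G),
  [/\ hpath_del x s, ~~ edge x (head x s) & forall y : G, degree y <= degree x].
Proof.
have [n3 _ _] := platG.
have [x degx] := max_degreeP (ltn_trans (isT : 0 < 2) n3).
have maxx (y : G) : degree y <= degree x by rewrite -degx; apply: leq_bigmax.
exists x; have [s hs] := platypus_path platG x.
case: s hs => [|a t] hs; first by exists [::]; rewrite /= edge_irrefl.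
have [xa|xa] := boolP (edge x a); last by exists (a :: t).
(* Since the first vertex is adjacent to [x], the last one is not, and the reversed path
   qualifies. *)
exists (rev (a :: t)); split=> //; first exact: hpath_del_rev.
have -> : rev (a :: t) = last a t :: rev (belast a t) by rewrite lastI rev_rcons.
by rewrite /= (hpath_del_ends platG hs xa).
Qed.

Lemma platypus_search (final : seq (seq bool) -> bool) (C : Prop) :
  (forall (x : G) (s : seq G) t, let r := x :: s in uniq r -> (forall y, y \in r) ->
     final t ->
     (forall u v, u < order_of G -> v < order_of G -> label_rel x r u v = rel_of t u v) -> C) ->
  search_all (order_of G) final -> C.
Proof.
move=> finalP; have [x [s [hs xs maxx]]] := platypus_labelling.
have [es Us ms] := hs; pose r := x :: s.
have Ur : uniq r by rewrite /= ms eqxx.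
have mr y : y \in r by rewrite inE ms; case: eqP.
have [n3 _ _] := platG.
have szr := size_labelling Ur mr.
rewrite -szr in n3 *; apply: (search_allP (e := label_rel x r)).
- exact: ltnW.
- exact: label_rel_sym.
- exact: label_rel_irr.
- by move=> c; apply: label_rel_cycle.
- by move=> w; apply: label_rel_trace.
- move=> [|i] // _; rewrite ltnS /label_rel /= => lti.
  by move/(sortedP x): es; apply.
- by rewrite /label_rel /= -(nth0 x) in xs *.
- rewrite label_rel_degree // szr (leq_trans _ (platypus_max_degree platG)) //.
  by rewrite leq_add2r; apply: leq_bigmax.
- by move=> v vn; rewrite !label_rel_degree.
- by move=> t ft tP; apply: (finalP x s t) => // u v; rewrite -szr; apply: tP.
Qed.

Lemma platypus_order_ge9 : 9 <= order_of G.
Proof.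
have [n3 _ _] := platG; rewrite leqNgt; apply/negP => n9.
by have := @no_platypus_search (order_of G); rewrite n3 n9 => /(_ isT); apply: platypus_search.
Qed.

Lemma platypus_order9 : order_of G = 9 -> exists2 k, k < 4 & isomorphic G (nine k).
Proof.
move=> n9; have := nine_search; rewrite -[in search_all _]n9; apply: platypus_search.
move=> x s t r Ur mr; rewrite n9 /is_nine has_lazyE => /hasP[k]; rewrite mem_iota => k4 ext tP.
exists k => //.
have [//|q pq qP] :=
  extend_isoP (s := iota 0 9) (symm_sym _) (symm_sym _) (symm_irr _) (symm_irr _) ext.
have sz9 : size r = 9 by rewrite (size_labelling Ur mr).
have := @isomorphic_graph_on G x r Ur mr (nine_rel k) q; rewrite sz9; apply=> // i j lti ltj.
have szq : size q = 9 by rewrite (perm_size pq).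
(* [label_rel] is symmetric and irreflexive, so [symm] does not change the relation of [t] on
   indices below 9. *)
rewrite -qP ?szq // /symm -!tP //; case: eqP => [->|_]; first exact: label_rel_irr.
by rewrite [label_rel _ _ j i]label_rel_sym; case: (label_rel _ _ i j).
Qed.

End Classification.

(** * Degree invariants of the four graphs *)

Lemma isomorphic_degree (G H : sgraph) (f : G -> H) x :
  bijective f -> (forall x y, edge (f x) (f y) = edge x y) -> degree (f x) = degree x.
Proof.
move=> fbij fE; have finj := bij_inj fbij; have [g _ gK] := fbij.
rewrite /degree -(card_imset _ finj); apply: eq_card => y.
by rewrite -[y]gK (mem_imset _ _ finj) !inE fE.
Qed.

Lemma isomorphic_max_degree (G H : sgraph) : isomorphic G H -> max_degree G = max_degree H.
Proof.
move=> [f fbij fE]; rewrite /max_degree [RHS](reindex f); last exact: onW_bij.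
by apply: eq_bigr => x _; rewrite isomorphic_degree.
Qed.

(** The degree sum tells the four graphs of order 9 apart, three of which share their maximum
    degree. *)
Lemma isomorphic_sum_degree (G H : sgraph) :
  isomorphic G H -> \sum_(x : G) degree x = \sum_(y : H) degree y.
Proof.
move=> [f fbij fE]; rewrite [RHS](reindex f); last exact: onW_bij.
by apply: eq_bigr => x _; rewrite isomorphic_degree.
Qed.

(** Recasts maxima and sums of degrees as folds over lists of numbers, which evaluate. *)
Lemma big_degree_graph_on (R : Type) (idx : R) (op : R -> R -> R) (F : nat -> R) n e :
  \big[op/idx]_(x : graph_on n e) F (degree x) =
  foldr op idx [seq F (count (symm e i) (iota 0 n)) | i <- iota 0 n].
Proof.
pose f i := F (count (symm e i) (iota 0 n)).
rewrite foldrE big_map; transitivity (\big[op/idx]_(i < n) f i).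
  by apply: eq_bigr => i _; rewrite degree_graph_on.
by rewrite -(big_mkord xpredT f) /index_iota subn0.
Qed.

Lemma nine_max_degree k : k < 4 -> max_degree (nine k) = if k == 0 then 3 else 4.
Proof.
rewrite /max_degree (big_degree_graph_on _ _ id).
by case: k => [|[|[|[|k]]]] // _; vm_compute.
Qed.

Lemma nine_sum_degree k : k < 4 -> \sum_(x : nine k) degree x = 24 + k.*2.
Proof.
rewrite (big_degree_graph_on _ _ id).
by case: k => [|[|[|[|k]]]] // _; vm_compute.
Qed.

(** * Platypuses of order at least 10 *)

(** Vertex 0 has degree 6, and the only neighbours of 9 in the base graph are 0 and 2, which are
    adjacent. *)
Definition base_rel := edge_list
  [:: (0, 2); (0, 4); (0, 5); (0, 7); (0, 8); (0, 9); (2, 9); (2, 3); (2, 6);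
      (3, 4); (3, 8); (4, 5); (5, 6); (1, 5); (6, 7); (7, 8); (1, 8); (9, 9)].
Definition base_adj i j := if base_rel i j then true else base_rel j i.

(* All vertices from 9 on are copies of vertex 9 of the base graph, and the loop
   (9, 9) makes them pairwise adjacent. *)
Definition twin_rel : rel nat := fun i j => base_rel (minn i 9) (minn j 9).

Lemma symm_twin i j : symm twin_rel i j = (i != j) && base_adj (minn i 9) (minn j 9).
Proof. by rewrite /symm /base_adj; case: eqP. Qed.

(** The closed neighbourhood of 9 in the base graph. *)
Definition twin_nbr i := [|| i == 0, i == 2 | i == 9].

Lemma twin_nbrP i j : 9 <= i -> symm twin_rel i j -> twin_nbr (minn j 9).
Proof.
have: all (fun j => base_adj 9 j ==> twin_nbr j) (iota 0 10) by vm_compute.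
move=> /allP H i9; rewrite symm_twin (minn_idPr i9) => /andP[_]; apply/implyP/H.
by rewrite mem_iota /= ltnS geq_minr.
Qed.

(** Checked on representatives: equal ones below 9 come from equal vertices, and distinct twins are
    adjacent through the loop at 9. *)
Lemma twin_nbr_clique i j :
  i != j -> twin_nbr (minn i 9) -> twin_nbr (minn j 9) -> symm twin_rel i j.
Proof.
have: all (fun i => all (fun j => twin_nbr i ==> twin_nbr j ==>
   ((i == j) && (i != 9) || base_adj i j)) (iota 0 10)) (iota 0 10) by vm_compute.
move=> /allP H ij ti tj; rewrite symm_twin ij /=.
have in10 l : minn l 9 \in iota 0 10 by rewrite mem_iota /= ltnS geq_minr.
have /implyP/(_ ti)/implyP/(_ tj) := allP (H _ (in10 i)) _ (in10 j).
case/orP=> // /andP[/eqP Eij i9]; case/negP: ij; apply/eqP.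
have lt9 l : minn l 9 != 9 -> minn l 9 = l by case: (leqP l 9).
by rewrite -(lt9 i i9) Eij lt9 // -Eij.
Qed.

(* The last twin is simplicial, hence can be deleted from a hamiltonian cycle. *)
Lemma twin_no_cycle k c : perm_eq c (iota 0 (10 + k)) -> ~~ cycle (symm twin_rel) c.
Proof.
elim: k c => [|k IH] c pc.
  by apply: no_ham_cycleP pc _; rewrite // addn0; vm_compute.
apply/negP => cc; have mc : 10 + k \in c.
  by rewrite (perm_mem pc) mem_iota addnS /=.
have [i q Ec] := rot_to mc; move: cc; rewrite -(rot_cycle i) Ec.
have pq : perm_eq q (iota 0 (10 + k)).
  rewrite -(perm_cons (10 + k)) -Ec perm_rot (perm_trans pc) // addnS -addn1 iotaD.
  by rewrite -[iota _ 1]/[:: 10 + k] cats1 perm_rcons.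
case: q {Ec} pq (IH _ pq) => [|a q] pq ncq; first by move: (perm_size pq); rewrite size_iota.
rewrite /= rcons_path => /and3P[ea aq eb]; case/negP: ncq; rewrite /= rcons_path aq /=.
have k9 : 9 <= 10 + k by rewrite ltnW // leq_addr.
apply: twin_nbr_clique.
(* The remaining path has at least ten vertices, so its ends differ. *)
- have : uniq (a :: q) by rewrite (perm_uniq pq) iota_uniq.
  case/lastP: q pq {aq eb} => [/perm_size|q b _]; first by rewrite size_iota.
  by rewrite last_rcons /= mem_rcons inE negb_or eq_sym => /andP[/andP[]].
- by apply: twin_nbrP k9 _; rewrite symm_sym.
- exact: twin_nbrP k9 ea.
Qed.

(** Each path covers the vertices below 9 except [w] and ends in 0 or 2, ready to enter the clique
    of twins; the last one serves every [w] from 9 on. *)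
Definition twin_path w := nth [::]
  [:: [:: 1; 5; 4; 3; 8; 7; 6; 2]; [:: 0; 4; 5; 6; 7; 8; 3; 2];
      [:: 1; 5; 6; 7; 8; 3; 4; 0]; [:: 0; 4; 5; 1; 8; 7; 6; 2];
      [:: 0; 7; 6; 5; 1; 8; 3; 2]; [:: 1; 8; 3; 4; 0; 7; 6; 2];
      [:: 0; 7; 8; 1; 5; 4; 3; 2]; [:: 0; 4; 3; 8; 1; 5; 6; 2];
      [:: 1; 5; 4; 3; 2; 6; 7; 0]; [:: 6; 7; 8; 1; 5; 4; 3; 2; 0]] (minn w 9).

Lemma twin_pathP w :
  perm_eq (twin_path w) (rem w (iota 0 9)) /\ sorted base_adj (rcons (twin_path w) 9).
Proof.
have: all (fun w => perm_eq (twin_path w) (rem w (iota 0 9)) &&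
                    sorted base_adj (rcons (twin_path w) 9)) (iota 0 10) by vm_compute.
move=> /allP H; have /H/andP[] : minn w 9 \in iota 0 10 by rewrite mem_iota /= ltnS geq_minr.
rewrite /twin_path -minnA minnn => pw sw; split=> //; move: pw.
case: (leqP w 9) => // w9; rewrite (rem_id (x := 9)) // (rem_id (x := w)) //.
by rewrite mem_iota -leqNgt ltnW.
Qed.

Lemma twin_trace n w : 10 <= n -> w < n ->
  exists2 q, perm_eq q (rem w (iota 0 n)) & sorted (symm twin_rel) q.
Proof.
move=> n10 wn; have [pw sw] := twin_pathP w; pose s := rem w (iota 9 (n - 9)).
have n9 : 9 <= n by exact: ltnW.
have mp i : (i \in twin_path w) = (i != w) && (i < 9).
  by rewrite (perm_mem pw) mem_rem_uniq ?iota_uniq // inE mem_iota.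
have ms i : (i \in s) = [&& i != w, 9 <= i & i < n].
  by rewrite mem_rem_uniq ?iota_uniq // inE mem_iota subnKC.
have Uq : uniq (twin_path w ++ s).
  rewrite cat_uniq (perm_uniq pw) !rem_uniq ?iota_uniq // andbT /=.
  by apply/hasPn => i; rewrite ms mp => /and3P[_ i9 _]; rewrite ltnNge i9 andbF.
exists (twin_path w ++ s).
  apply: uniq_perm; rewrite ?rem_uniq ?iota_uniq // => i.
  rewrite mem_cat mp ms mem_rem_uniq ?iota_uniq // inE mem_iota /= add0n.
  by case: (i == w) => //=; case: ltnP => //= i9; rewrite (leq_trans i9).
(* Adjacency is split into distinctness, which follows from [Uq], and adjacency of representatives,
   where the twins become a run of 9s joined by the loop. *)
have -> : sorted (symm twin_rel) =1
    sorted [rel i j | (i != j) && base_adj (minn i 9) (minn j 9)].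
  by apply: eq_sorted => i j; exact: symm_twin.
rewrite (sorted_relI (fun i j => i != j) (fun i j => base_adj (minn i 9) (minn j 9))).
apply/andP; split; first by apply: pairwise_sorted; rewrite -uniq_pairwise.
rewrite -(@sorted_map _ _ (minn^~ 9) base_adj) map_cat.
have -> : map (minn^~ 9) (twin_path w) = twin_path w.
  apply: map_id_in => i; rewrite mp => /andP[_ i9]; exact/minn_idPl/ltnW.
have -> : map (minn^~ 9) s = nseq (size s) 9.
  rewrite -(size_map (minn^~ 9)); apply/all_pred1P/allP => _ /mapP[i + ->].
  by rewrite ms => /and3P[_ i9 _]; apply/eqP/minn_idPr.
(* No twin is left when [n] is 10 and [w] is 9. *)
case: (size s) => [|k] /=.
  by move: sw; rewrite cats0 -cats1 => /cat_sorted2[].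
by rewrite sorted_cat_cons sw /=; elim: k.
Qed.

Lemma platypus_twin n : 10 <= n -> platypus (graph_on n twin_rel).
Proof.
move=> n10; apply: platypus_graph_on => [|c|w]; first exact: leq_trans n10.
  by rewrite -(subnKC n10); exact: twin_no_cycle.
exact: twin_trace.
Qed.

Lemma twin_max_degree n : 10 <= n -> max_degree (graph_on n twin_rel) = n - 4.
Proof.
move=> n10; have n9 : 9 <= n by exact: ltnW.
apply/eqP; rewrite eqn_leq; apply/andP; split.
  have := platypus_max_degree (platypus_twin n10).
  by rewrite order_graph_on addnC -leq_subRL // (leq_trans _ n10).
have n0 : 0 < n by exact: leq_trans n10.
pose z : graph_on n twin_rel := Ordinal n0.
apply: leq_trans (leq_bigmax z); rewrite degree_graph_on /=.
have -> : iota 0 n = iota 0 9 ++ iota 9 (n - 9) by rewrite -iotaD subnKC.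
(* Below 9 the neighbours of vertex 0 are 2, 4, 5, 7 and 8; all [n - 9] twins are added to them. *)
rewrite count_cat (_ : count _ (iota 0 9) = 5); last by vm_compute.
rewrite (@eq_in_count _ _ xpredT) => [|i].
  by rewrite count_predT size_iota addnBA // -[n - 4](subnDl 5).
rewrite mem_iota symm_twin => /andP[i9 _]; rewrite (minn_idPr i9).
by case: i i9.
Qed.

Theorem theorem11 :
  [/\ (* the bound; stated additively since subtraction on nat is truncated *)
      forall G : sgraph, platypus G -> max_degree G + 4 <= order_of G,
      (* the platypuses of order at most 9 *)
      exists P : 'I_4 -> sgraph,
        [/\ forall i, platypus (P i) /\ order_of (P i) = 9,
            forall i j, isomorphic (P i) (P j) -> i = j,
            forall H : sgraph, platypus H -> order_of H <= 9 ->
              exists i, isomorphic H (P i),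
            max_degree (P ord0) = 3
          & forall i, i != ord0 -> max_degree (P i) = 4],
      (* the bound is not attained for n = 9 *)
      ~ (exists G : sgraph,
           [/\ platypus G, order_of G = 9 & max_degree G = 9 - 4])
    & (* the bound is attained for every n >= 10 *)
      forall n : nat, 10 <= n ->
        exists G : sgraph,
          [/\ platypus G, order_of G = n & max_degree G = n - 4]].
Proof.
split.
- exact: platypus_max_degree.
- exists (fun i : 'I_4 => nine i); split.
  + by move=> i; split; [exact: platypus_nine | exact: order_graph_on].
  + move=> i j /isomorphic_sum_degree; rewrite !nine_sum_degree // => /addnI.
    by move=> /(congr1 half); rewrite !doubleK => /val_inj.
  + move=> H platH H9.
    have [|k k4 Hk] := platypus_order9 platH; last by exists (Ordinal k4).
    by apply/eqP; rewrite eqn_leq H9 platypus_order_ge9.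
  + exact: nine_max_degree.
  + by move=> i i0; rewrite nine_max_degree // ifN.
- case=> G [platG G9]; have [k k4 /isomorphic_max_degree ->] := platypus_order9 platG G9.
  by rewrite nine_max_degree //; case: ifP.
- move=> n n10; exists (graph_on n twin_rel); split.
  + exact: platypus_twin.
  + exact: order_graph_on.
  + exact: twin_max_degree.
Qed.
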